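(* Let $X$ be a set and let $\overline{x}\notin X$. Then the symmetric inverse semigroup $\mathcal{IS}_X$ embeds isomorphically into $\mathcal{IP}_{X\cup\{\overline{x}\}}$, i.e. there is an injective semigroup homomorphism $\mathcal{IS}_X\to\mathcal{IP}_{X\cup\{\overline{x}\}}$.
   Context: $\mathcal{IS}_X$ denotes the symmetric inverse semigroup on $X$: all bijections between subsets of $X$ (including the empty map), with composition of partial maps, written left to right (first $s$, then $t$ in the product $st$). For an arbitrary set $X$ let $X'=\{x':x\in X\}$ be a disjoint copy of $X$, with $x\mapsto x'$ a fixed bijection $X\to X'$; the inverse bijection is also denoted by $'$. Let $\mathcal{CS}_X$ be the set of all partitions of $X\cup X'$ into nonempty blocks. For $a\in\mathcal{CS}_X$ write $x\equiv_a y$ if $x,y\in X\cup X'$ lie in the same block of $a$. The product $ab$ of $a,b\in\mathcal{CS}_X$ is the partition corresponding to the equivalence relation $\equiv$ on $X\cup X'$ defined, for $x,y\in X$, by: (i) $x\equiv y$ iff $x\equiv_a y$ or there are $s\ge 1$ and $c_1,\dots,c_{2s}\in X$ with $x\equiv_a c_1'$, $c_1\equiv_b c_2$, $c_2'\equiv_a c_3'$, $\dots$, $c_{2s-1}\equiv_b c_{2s}$, $c_{2s}'\equiv_a y$; (ii) $x'\equiv y'$ iff $x'\equiv_b y'$ or there are $s\ge 1$ and $c_1,\dots,c_{2s}\in X$ with $x'\equiv_b c_1$, $c_1'\equiv_a c_2'$, $c_2\equiv_b c_3$, $\dots$, $c_{2s-1}'\equiv_a c_{2s}'$, $c_{2s}\equiv_b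 y'$; (iii) $x\equiv y'$ iff $y'\equiv x$ iff there are $s\ge 1$ and $c_1,\dots,c_{2s-1}\in X$ with $x\equiv_a c_1'$, $c_1\equiv_b c_2$, $c_2'\equiv_a c_3'$, $\dots$, $c_{2s-2}'\equiv_a c_{2s-1}'$, $c_{2s-1}\equiv_b y'$. With this product $\mathcal{CS}_X$ is a semigroup, and $\mathcal{IP}_X$ is the subsemigroup of all $a\in\mathcal{CS}_X$ each of whose blocks meets both $X$ and $X'$. *)

(* Defs.v *)
From HB Require Import structures.
From Stdlib Require Import Relations.
From mathcomp Require Import all_boot.
From mathcomp Require Import boolp classical_sets.

Set Implicit Arguments.
Unset Strict Implicit.
Unset Printing Implicit Defensive.

Local Open Scope classical_set_scope.

(* A bijection between subsets of X is encoded as a partial map X -> option X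
   that is injective on its domain; the other subset is its image. *)
Record IS (X : Type) := MkIS {
  pmap_of :> X -> option X;
  pmap_inj : {in [pred x | isSome (pmap_of x)] &, injective pmap_of} }.

(* inl x stands for x and inr x for x'. *)
Record CS (X : Type) := MkCS {
  blocks : set (set (X + X));
  blocksP : partition blocks id [set: X + X] }.

HB.instance Definition _ X := gen_eqMixin (IS X).
HB.instance Definition _ X := gen_choiceMixin (IS X).
HB.instance Definition _ X := gen_eqMixin (CS X).
HB.instance Definition _ X := gen_choiceMixin (CS X).

Section SymmetricInverseSemigroup.
Variable X : Type.
Implicit Types s t u : IS X.

Lemma IS_eq s t : s =1 t -> s = t.
Proof.
case: s t => [f fi] [g gi] /= /funext fg; case: _ / fg gi => gi.
by congr MkIS; apply: Prop_irrelevance.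
Qed.

Lemma IS_mul_subproof s t :
  {in [pred x | isSome (pcomp t s x)] &, injective (pcomp t s)}.
Proof.
rewrite /pcomp => x y; rewrite !inE.
case sx: (s x) => [x'|] //=; case sy: (s y) => [y'|] //= tx ty txy.
apply: (@pmap_inj _ s); rewrite ?inE ?sx ?sy //.
by congr Some; apply: (@pmap_inj _ t).
Qed.

(* pcomp t s applies s first. *)
Definition IS_mul s t : IS X := MkIS (@IS_mul_subproof s t).

Lemma IS_mulA : associative IS_mul.
Proof.
by move=> s t u; apply: IS_eq => x; rewrite /= /pcomp /=; case: (s x).
Qed.

HB.instance Definition _ := isSemigroup.Build (IS X) IS_mulA.

End SymmetricInverseSemigroup.

Definition same_block X (a : CS X) (u v : X + X) : Prop :=
  exists B, [/\ blocks a B, B u & B v].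

(* R (c 1) (c 2), S (c 2) (c 3), R (c 3) (c 4), and so on up to c n. *)
Definition alternating X (R S : X -> X -> Prop) (c : nat -> X) (n : nat) :=
  forall k, 0 < k < n ->
    if odd k then R (c k) (c k.+1) else S (c k) (c k.+1).

Definition prod_equiv X (a b : CS X) (u v : X + X) : Prop :=
  let topb x y := same_block b (inl x) (inl y) in
  let bota x y := same_block a (inr x) (inr y) in
  match u, v with
  | inl x, inl y =>
      same_block a (inl x) (inl y) \/
      exists s (c : nat -> X),
        [/\ 0 < s, same_block a (inl x) (inr (c 1)),
            alternating topb bota c (2 * s)
          & same_block a (inr (c (2 * s))) (inl y)]
  | inr x, inr y =>
      same_block b (inr x) (inr y) \/
      exists s (c : nat -> X),
        [/\ 0 < s, same_block b (inr x) (inl (c 1)),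
            alternating bota topb c (2 * s)
          & same_block b (inl (c (2 * s))) (inr y)]
  | inl x, inr y | inr y, inl x =>
      exists s (c : nat -> X),
        [/\ 0 < s, same_block a (inl x) (inr (c 1)),
            alternating topb bota c (2 * s - 1)
          & same_block b (inl (c (2 * s - 1))) (inr y)]
  end.

Section PartitionOfEquivalence.
Variables (T : Type) (R : T -> T -> Prop).

Definition eqclasses : set (set T) := range (fun u => [set v | R u v]).

Lemma eqclasses_partition : equivalence T R -> partition eqclasses id [set: T].
Proof.
case=> Rr Rt Rs; split.
- apply/seteqP; split=> // u _; exists [set v | R u v]; last exact: Rr.
  by exists u.
- move=> _ _ [u _ <-] [v _ <-] [w [/= uw vw]]; apply/seteqP.
  by split=> z /= ?; [apply: (Rt) vw _; apply: (Rt) (Rs _ _ uw) _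
                     |apply: (Rt) uw _; apply: (Rt) (Rs _ _ vw) _].
- by move=> _ [u _ <-]; exists u; apply: Rr.
Qed.

End PartitionOfEquivalence.

Section SameBlock.
Variable X : Type.
Implicit Types a b : CS X.

Lemma same_block_refl a u : same_block a u u.
Proof.
have [Hc _ _] := blocksP a.
have : [set: X + X] u by [].
by rewrite -Hc => -[B aB Bu]; exists B.
Qed.

Lemma same_block_sym a u v : same_block a u v -> same_block a v u.
Proof. by case=> B [? ? ?]; exists B. Qed.

Lemma block_uniq a B C u : blocks a B -> blocks a C -> B u -> C u -> B = C.
Proof. by have [_ Ht _] := blocksP a => aB aC Bu Cu; apply: Ht => //; exists u. Qed.

Lemma same_block_trans a v u w :
  same_block a u v -> same_block a v w -> same_block a u w.
Proof.
case=> B [aB Bu Bv] [C [aC Cv Cw]]; exists B; split=> //.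
by rewrite (block_uniq aB aC Bv Cv).
Qed.

Lemma blocksE a : blocks a = eqclasses (same_block a).
Proof.
have [_ _ Hn] := blocksP a.
apply/seteqP; split=> [B aB|_ [u _ <-]].
  have [u Bu] := Hn _ aB; exists u => //; apply/seteqP; split=> v /=.
    by case=> C [aC Cu Cv]; rewrite (block_uniq aB aC Bu Cu).
  by move=> Bv; exists B.
have [B [aB Bu _]] := same_block_refl a u.
suff -> : [set v | same_block a u v] = B by [].
apply/seteqP; split=> v /=; last by move=> Bv; exists B.
by case=> C [aC Cu Cv]; rewrite (block_uniq aB aC Bu Cu).
Qed.

Lemma CS_eq a b : (forall u v, same_block a u v <-> same_block b u v) -> a = b.
Proof.
move=> ab; have : same_block a = same_block b.
  by apply/funext => u; apply/funext => v; apply/propext.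
have := blocksE a; have := blocksE b.
case: a b {ab} => [A HA] [B HB] /= BE AE ab.
have AB : A = B by rewrite AE BE ab.
by case: _ / AB HB {BE ab} => HB; congr MkCS; apply: Prop_irrelevance.
Qed.

Lemma same_block_eqclasses a R (Re : equivalence _ R) :
  blocks a = eqclasses R -> forall u v, same_block a u v <-> R u v.
Proof.
case: Re => Rr Rt Rs aE u v; rewrite /same_block aE; split.
  by case=> _ [[w _ <-] /= wu wv]; apply: Rt wv; apply: Rs.
by move=> uv; exists [set w | R u w]; split=> //; exists u.
Qed.

End SameBlock.

Local Notation conn := (clos_refl_sym_trans _).
Local Notation "R |+| S" := (union _ R S) (at level 50, left associativity).

(* The product of a and b is described by connectivity in a graph whose
   vertices are layered copies of X: a sits on layers i, j and b on layers
   j, k. *)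
Definition layer X (i j : nat) (u : X + X) : nat * X :=
  match u with inl x => (i, x) | inr x => (j, x) end.

Definition lift X (i j : nat) (R : X + X -> X + X -> Prop) :
    relation (nat * X) :=
  fun p q => exists u v, [/\ p = layer i j u, q = layer i j v & R u v].

Section Alternating.
Variables (X : Type) (R S : X -> X -> Prop).

Lemma alternating_conn c n :
  alternating R S c n.+1 -> conn (R |+| S) (c 1) (c n.+1).
Proof.
elim: n => [|n IH] H; first exact: rst_refl.
apply: (rst_trans _ _ _ (c n.+1)).
  apply: IH => k /andP[k0 kn]; apply: H.
  by rewrite k0 /= (leq_trans kn).
apply: rst_step.
have := H n.+1; rewrite ltnS leqnn => /(_ isT).
by case: ifP => _ ?; [left|right].
Qed.

Definition ext (c : nat -> X) n x := fun k => if k <= n then c k else x.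

Lemma alternating_ext c n x :
  alternating R S c n -> (if odd n then R (c n) x else S (c n) x) ->
  alternating R S (ext c n x) n.+1.
Proof.
move=> H Hx k /andP[k0]; rewrite ltnS leq_eqVlt => /orP[/eqP ->|kn].
  by rewrite /ext leqnn ltnn.
by rewrite /ext (ltnW kn) kn; apply: H; rewrite k0.
Qed.

Lemma conn_alternating x y :
  (forall x, R x x) -> (forall x, S x x) ->
  (forall x y, R x y -> R y x) -> (forall x y, S x y -> S y x) ->
  conn (R |+| S) x y -> exists s c,
    [/\ 0 < s, c 1 = x, c (2 * s) = y & alternating R S c (2 * s)].
Proof.
move=> Rr Sr Rs Ss /(clos_rst_rstn1 _ _ _ _) xy.
elim: xy => {y} [|y' z yz _ [s [c [s0 c1 c2 H]]]].
  exists 1, (fun=> x); split=> // k _.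
  by case: ifP.
have Hyz : R y' z \/ S y' z.
  by case: yz => -[] ?; [left|right|left; apply: Rs|right; apply: Ss].
have s2 : 0 < 2 * s by rewrite muln_gt0.
have odd2 : odd (2 * s) = false by rewrite oddM.
have [w [Sw Rw]] : exists w, S y' w /\ R w z.
  by case: Hyz => ?; [exists y'|exists z].
exists s.+1, (ext (ext c (2 * s) w) (2 * s).+1 z).
rewrite mulnS addSn add1n; split=> //.
- by rewrite /ext /= s2.
- by rewrite /ext ltnn.
- apply: alternating_ext; first apply: alternating_ext => //.
    by rewrite odd2 c2.
  by rewrite /= odd2 /= /ext ltnn.
Qed.

End Alternating.

Section Product.
Variable X : Type.
Implicit Types (a b c : CS X) (p q r : nat * X).

Section TwoFactors.
Variables (a b : CS X).

Let topb x y := same_block b (inl x) (inl y).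
Let bota x y := same_block a (inr x) (inr y).
Let M := conn (topb |+| bota).

Let M_sym x y : M x y -> M y x. Proof. exact: rst_sym. Qed.

Let MC x y : M x y <-> conn (bota |+| topb) x y.
Proof.
split; elim=> {x y} [x y []H|x|x y _ H|x y z _ H1 _ H2];
  try (by apply: rst_step; left); try (by apply: rst_step; right);
  try exact: rst_refl; try exact: rst_sym; exact: rst_trans H1 H2.
Qed.

Let link z u := match u with
  | inl x => same_block a (inr z) (inl x)
  | inr x => same_block b (inl z) (inr x)
  end.

Let base u v := match u, v with
  | inl x, inl y => same_block a (inl x) (inl y)
  | inr x, inr y => same_block b (inr x) (inr y)
  | _, _ => False
  end.

Let prod' u v := base u v \/ exists z w, [/\ link z u, M z w & link w v].

Let prod'_sym u v : prod' u v -> prod' v u.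
Proof.
case=> [H|[z [w [? /M_sym ? ?]]]]; last by right; exists w, z.
by left; case: u v H => [x|x] [y|y] //=; apply: same_block_sym.
Qed.

Let topb_refl x : topb x x. Proof. exact: same_block_refl. Qed.
Let bota_refl x : bota x x. Proof. exact: same_block_refl. Qed.
Let topb_sym x y : topb x y -> topb y x. Proof. exact: same_block_sym. Qed.
Let bota_sym x y : bota x y -> bota y x. Proof. exact: same_block_sym. Qed.

Let prod_equiv_lr x y :
  prod_equiv a b (inl x) (inr y) <-> prod' (inl x) (inr y).
Proof.
split=> [[s [c [s0 xc H yc]]]|[//|[z [w [xz zw yw]]]]].
  right; exists (c 1), (c (2 * s - 1)); split=> //; first exact: same_block_sym.
  move: s0 H; case: s {yc} => // s _.
  by rewrite mulnS add2n subn1; apply: alternating_conn.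
have [s [c [s0 c1 c2 H]]] :=
  conn_alternating topb_refl bota_refl topb_sym bota_sym zw.
exists s.+1, (ext c (2 * s) w).
have -> : 2 * s.+1 - 1 = (2 * s).+1 by rewrite mulnS add2n subn1.
split=> //.
- by rewrite /ext muln_gt0 s0 c1; apply: same_block_sym.
- by apply: alternating_ext => //; rewrite oddM /= c2; apply: bota_refl.
- by rewrite /ext ltnn.
Qed.

Lemma prod_equivE u v : prod_equiv a b u v <-> prod' u v.
Proof.
case: u v => [x|x] [y|y].
- split=> [[|[s [c [s0 xc H yc]]]]|[|[z [w [xz zw yw]]]]]; try (by left).
    right; exists (c 1), (c (2 * s)); split=> //; first exact: same_block_sym.
    by case: s s0 H {yc} => // s _; apply: alternating_conn.
  have [s [c [s0 c1 c2 H]]] :=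
    conn_alternating topb_refl bota_refl topb_sym bota_sym zw.
  by right; exists s, c; rewrite c1 c2; split=> //; apply: same_block_sym.
- exact: prod_equiv_lr.
- by split=> [/prod_equiv_lr/prod'_sym|/prod'_sym/prod_equiv_lr].
- split=> [[|[s [c [s0 xc H yc]]]]|[|[z [w [xz /MC zw yw]]]]]; try (by left).
    right; exists (c 1), (c (2 * s)); split=> //; first exact: same_block_sym.
    by apply/MC; case: s s0 H {yc} => // s _; apply: alternating_conn.
  have [s [c [s0 c1 c2 H]]] :=
    conn_alternating bota_refl topb_refl bota_sym topb_sym zw.
  by right; exists s, c; rewrite c1 c2; split=> //; apply: same_block_sym.
Qed.

Variables (i j k : nat).
Hypotheses (ij : i <> j) (jk : j <> k) (ik : i <> k).

Let G := lift i j (same_block a) |+| lift j k (same_block b).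

Let G_sym p q : G p q -> G q p.
Proof.
by case=> -[u [v [-> -> H]]]; [left|right]; exists v, u; split=> //;
   apply: same_block_sym.
Qed.

Let M_conn x y : M x y -> conn G (j, x) (j, y).
Proof.
elim=> {x y} [x y []H|x|x y _ ?|x y z _ H1 _ H2].
- by apply: rst_step; right; exists (inl x), (inl y).
- by apply: rst_step; left; exists (inr x), (inr y).
- exact: rst_refl.
- exact: rst_sym.
- exact: rst_trans H1 H2.
Qed.

Let link_conn z u : link z u -> conn G (j, z) (layer i k u).
Proof.
case: u => x H; apply: rst_step; [left|right].
- by exists (inr z), (inl x).
- by exists (inl z), (inr x).
Qed.

Let Q u p :=
  [\/ p.1 = i /\ prod' u (inl p.2), p.1 = k /\ prod' u (inr p.2)
    | p.1 = j /\ exists z, link z u /\ M z p.2].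

Let Q_step u p q : G p q -> Q u p -> Q u q.
Proof.
have [ji kj ki] : [/\ j <> i, k <> j & k <> i] by split; exact: nesym.
case=> -[v [w [-> -> H]]].
- case: v H => [x|x] H.
  + case=> -[] //= _ ux; case: w H => [y|y] H.
    * apply: Or31; split=> //; case: ux => [ux|[z [w [? ? wx]]]].
        by left; case: u ux => //= x' ?; apply: same_block_trans H.
      by right; exists z, w; split=> //; apply: same_block_trans H.
    * apply: Or33; split=> //; case: ux => [|[z [w [zu zw wx]]]].
        case: u => //= x' H'; exists y; split; last exact: rst_refl.
        by apply: same_block_sym; apply: same_block_trans H.
      exists z; split=> //; apply: rst_trans zw _.
      by apply: rst_step; right; apply: same_block_trans H.
  + case=> -[] //= _ [z [zu zx]]; case: w H => [y|y] H.
    * by apply: Or31; split=> //; right; exists z, x.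
    * apply: Or33; split=> //; exists z; split=> //; apply: rst_trans zx _.
      by apply: rst_step; right.
- case: v H => [x|x] H.
  + case=> -[] //= _ [z [zu zx]]; case: w H => [y|y] H.
    * apply: Or33; split=> //; exists z; split=> //; apply: rst_trans zx _.
      by apply: rst_step; left.
    * by apply: Or32; split=> //; right; exists z, x.
  + case=> -[] //= _ ux; case: w H => [y|y] H.
    * apply: Or33; split=> //; case: ux => [|[z [w [zu zw wx]]]].
        case: u => //= x' H'; exists y; split; last exact: rst_refl.
        by apply: same_block_sym; apply: same_block_trans H.
      exists z; split=> //; apply: rst_trans zw _.
      by apply: rst_step; left; apply: same_block_trans H.
    * apply: Or32; split=> //; case: ux => [ux|[z [w [? ? wx]]]].
        by left; case: u ux => //= x' ?; apply: same_block_trans H.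
      by right; exists z, w; split=> //; apply: same_block_trans H.
Qed.

Lemma prod_equiv_conn u v :
  prod_equiv a b u v <-> conn G (layer i k u) (layer i k v).
Proof.
have [ji kj ki] : [/\ j <> i, k <> j & k <> i] by split; exact: nesym.
split=> [/prod_equivE[H|[z [w [zu zw wv]]]]|H].
- case: u v H => [x|x] [y|y] //= H; apply: rst_step; [left|right].
  + by exists (inl x), (inl y).
  + by exists (inr x), (inr y).
- apply: (rst_trans _ _ _ (j, z)); first exact/rst_sym/link_conn.
  by apply: (rst_trans _ _ _ (j, w)); [apply: M_conn|apply: link_conn].
- have Quu : Q u (layer i k u).
    case: u {H} => x; [apply: Or31|apply: Or32]; split=> //; left;
      exact: same_block_refl.
  have QE : Q u (layer i k u) <-> Q u (layer i k v).
    elim: H {Quu} => [p q pq|//|p q _ -> //|p q r _ -> _ -> //].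
    by split; apply: Q_step => //; apply: G_sym.
  apply/prod_equivE.
  by case: v {H} QE => y [/(_ Quu) [] [] //=].
Qed.

End TwoFactors.

Lemma prod_equiv_equivalence a b : equivalence _ (prod_equiv a b).
Proof.
have E u v := @prod_equiv_conn a b 0 1 2
  ltac:(by []) ltac:(by []) ltac:(by []) u v.
split=> [u|u v w /E uv /E vw|u v /E uv]; apply/E.
- exact: rst_refl.
- exact: rst_trans uv vw.
- exact: rst_sym.
Qed.

Definition CS_mul a b : CS X :=
  MkCS (eqclasses_partition (prod_equiv_equivalence a b)).

Lemma CS_mulE a b u v : same_block (CS_mul a b) u v <-> prod_equiv a b u v.
Proof. by apply: same_block_eqclasses => //; apply: prod_equiv_equivalence. Qed.

Section Eliminate.
Variables (a b : CS X) (i j k : nat).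
Hypotheses (ij : i <> j) (jk : j <> k) (ik : i <> k).
Variable G : relation (nat * X).
Hypothesis Gj : forall p q, G p q -> p.1 <> j /\ q.1 <> j.

Let AB := lift i j (same_block a) |+| lift j k (same_block b).
Let L := lift i k (same_block (CS_mul a b)).

Let AB_L p q : conn AB p q -> p.1 <> j -> q.1 <> j -> p = q \/ L p q.
Proof.
move=> H pj qj.
have : p = q \/ (p.1 \in [:: i; j; k]) /\ (q.1 \in [:: i; j; k]).
  elim: H {pj qj} => {p q} [p q|p|p q _|p q r _ H1 _ H2].
  - by case=> -[[x|x] [[y|y] [-> -> _]]]; right; rewrite !inE /= !eqxx ?orbT.
  - by left.
  - by case=> [->|[]]; [left|right].
  - case: H1 => [->//|[pI qI]]; right; split=> //.
    by case: H2 => [<-|[]].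
case=> [->|[pI qI]]; [by left|right].
have lay r : r.1 \in [:: i; j; k] -> r.1 <> j -> exists u, r = layer i k u.
  case: r => n x /=; rewrite !inE => /or3P[] /eqP -> // _.
    by exists (inl x).
  by exists (inr x).
have [u pu] := lay _ pI pj; have [v qv] := lay _ qI qj.
exists u, v; split=> //; apply/CS_mulE/(prod_equiv_conn _ _ ij jk ik).
by rewrite -pu -qv.
Qed.

Lemma conn_elim p q : p.1 <> j -> q.1 <> j ->
  conn (L |+| G) p q <-> conn (AB |+| G) p q.
Proof.
move=> pj qj; split=> H.
  elim: H {pj qj} => {p q} [p q []|p|p q _ H|p q r _ H1 _ H2].
  - move=> [u [v [-> -> /CS_mulE/(prod_equiv_conn _ _ ij jk ik)]]].
    elim=> {u v p q} [p q ?|p|p q _ ?|p q r _ H1 _ H2].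
    + by apply: rst_step; left.
    + exact: rst_refl.
    + exact: rst_sym.
    + exact: rst_trans H1 H2.
  - by move=> ?; apply: rst_step; right.
  - exact: rst_refl.
  - exact: rst_sym.
  - exact: rst_trans H1 H2.
pose Q r := exists w, [/\ w.1 <> j, conn (L |+| G) p w & conn AB w r].
have Qout r : Q r -> r.1 <> j -> conn (L |+| G) p r.
  case=> w [wj pw wr] rj; have [<- //|wr'] := AB_L wr wj rj.
  by apply: rst_trans pw _; apply: rst_step; left.
have Qp : Q p by exists p; split=> //; apply: rst_refl.
suff [PQ _] : Q p <-> Q q by apply: Qout qj; apply: PQ.
have QAB r s : AB r s -> Q r <-> Q s.
  move=> rs; split=> -[w [wj pw H']]; exists w; split=> //.
    by apply: rst_trans H' _; apply: rst_step.
  by apply: rst_trans H' _; apply: rst_sym; apply: rst_step.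
have QG r s : G r s -> Q r <-> Q s.
  move=> rs; have [rj sj] := Gj rs; split=> H'.
    exists s; split=> //; last exact: rst_refl.
    by apply: rst_trans (Qout _ H' rj) _; apply: rst_step; right.
  exists r; split=> //; last exact: rst_refl.
  by apply: rst_trans (Qout _ H' sj) _; apply: rst_sym; apply: rst_step; right.
have QE r s : conn (AB |+| G) r s -> Q r <-> Q s.
  elim=> {r s} [r s []|//|r s _ -> //|r s t _ -> _ -> //].
    exact: QAB.
  exact: QG.
exact: QE.
Qed.

End Eliminate.

Lemma conn_ext (R S : relation (nat * X)) p q :
  (forall p q, R p q -> S p q) -> conn R p q -> conn S p q.
Proof.
move=> RS; elim=> {p q} [r s /RS ?|r|r s _ ?|r s t _ H1 _ H2].
- exact: rst_step.
- exact: rst_refl.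
- exact: rst_sym.
- exact: rst_trans H1 H2.
Qed.

Lemma CS_mulA : associative CS_mul.
Proof.
move=> a b c; apply: CS_eq => u v.
have H1 := @prod_equiv_conn a (CS_mul b c) 0 1 3
  ltac:(by []) ltac:(by []) ltac:(by []) u v.
have H2 := @prod_equiv_conn (CS_mul a b) c 0 2 3
  ltac:(by []) ltac:(by []) ltac:(by []) u v.
have out n : 0 <> n -> 3 <> n -> forall u : X + X, (layer 0 3 u).1 <> n.
  by move=> n0 n3 [x|x].
have lay n i j (R : X + X -> X + X -> Prop) p q : i <> n -> j <> n ->
    lift i j R p q -> p.1 <> n /\ q.1 <> n.
  by move=> ? ? [[x|x] [[y|y] [-> -> _]]].
have E1 := @conn_elim a b 0 1 2 ltac:(by []) ltac:(by []) ltac:(by [])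
  (lift 2 3 (same_block c))
  (fun p q => lay 1 2 3 _ p q ltac:(by []) ltac:(by [])) (layer 0 3 u)
  (layer 0 3 v) (out 1 ltac:(by []) ltac:(by []) u)
  (out 1 ltac:(by []) ltac:(by []) v).
have E2 := @conn_elim b c 1 2 3 ltac:(by []) ltac:(by []) ltac:(by [])
  (lift 0 1 (same_block a))
  (fun p q => lay 2 0 1 _ p q ltac:(by []) ltac:(by [])) (layer 0 3 u)
  (layer 0 3 v) (out 2 ltac:(by []) ltac:(by []) u)
  (out 2 ltac:(by []) ltac:(by []) v).
split=> /CS_mulE H; apply/CS_mulE.
- apply/H2.
  have {}H : conn (lift 1 3 (same_block (CS_mul b c)) |+|
                   lift 0 1 (same_block a)) (layer 0 3 u) (layer 0 3 v).
    by move/H1: H; apply: conn_ext => p q [] ?; [right|left].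
  move/E2: H => H.
  apply/E1; apply: conn_ext H => p q.
  by move=> [[]|] ?; [left; right|right|left; left].
- apply/H1.
  have {}H : conn (lift 1 3 (same_block (CS_mul b c)) |+|
                   lift 0 1 (same_block a)) (layer 0 3 u) (layer 0 3 v).
    apply/E2; move/H2/E1: H; apply: conn_ext => p q.
    by move=> [[]|] ?; [right|left; left|left; right].
  by move: H; apply: conn_ext => p q [] ?; [right|left].
Qed.

End Product.

HB.instance Definition _ X := isSemigroup.Build (CS X) (@CS_mulA X).

Definition IP_pred X : {pred CS X} := fun a =>
  `[< forall B, blocks a B ->
        (exists x : X, B (inl x)) /\ (exists x : X, B (inr x)) >].

Lemma IP_mulg_closed X : mulg_closed (@IP_pred X).
Proof.
move=> a b /asboolP aP /asboolP bP; apply/asboolP => _ [u _ <-] /=.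
have [pr _ ps] := prod_equiv_equivalence a b.
have blk (c : CS X) w : (forall B, blocks c B ->
    (exists x : X, B (inl x)) /\ (exists x : X, B (inr x))) ->
  (exists x, same_block c w (inl x)) /\ (exists x, same_block c w (inr x)).
  move=> cP; have [B [cB Bw _]] := same_block_refl c w.
  by have [[x Bx] [y By]] := cP _ cB; split; [exists x|exists y]; exists B.
have mk x z y : same_block a (inl x) (inr z) -> same_block b (inl z) (inr y) ->
  prod_equiv a b (inl x) (inr y).
  move=> xz zy; exists 1, (fun=> z); split=> // k /andP[k0].
  by rewrite ltnNge k0.
case: u => x.
  split; first by exists x; apply: pr.
  have [_ [z xz]] := blk _ (inl x) aP; have [_ [y zy]] := blk _ (inl z) bP.
  by exists y; apply: mk xz zy.
split; last by exists x; apply: pr.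
have [[z xz] _] := blk _ (inr x) bP; have [[y zy] _] := blk _ (inr z) aP.
by exists y; apply: ps; apply: (mk _ z); apply: same_block_sym.
Qed.

Record IP (X : Type) := MkIP {
  part_of :> CS X;
  part_ofP : part_of \in @IP_pred X }.

HB.instance Definition _ X := [isSub for @part_of X].
HB.instance Definition _ X := [Choice of IP X by <:].
HB.instance Definition _ X :=
  SubChoice_isSubSemigroup.Build (CS X) _ (IP X) (@IP_mulg_closed X).

(* Main.v *)
(** Write the enlarged set as [option X], with [None] for [xbar].  A partial
    injection [s] is sent to the partition whose blocks are the pairs
    [{x, (s x)'}] with [x] in the domain of [s], and one further block
    containing everything else.  That last block contains both [xbar] and
    [xbar'], so it absorbs every path that is broken when forming a product. *)

From HB Require Import structures.
Require Import Defs.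
From Stdlib Require Import Relations.
From mathcomp Require Import all_boot.
From mathcomp Require Import boolp classical_sets.

Set Implicit Arguments.
Unset Strict Implicit.
Unset Printing Implicit Defensive.

Local Open Scope classical_set_scope.

Section ImageRestriction.
Variable X : Type.
Implicit Types (s t : IS X) (o : option X).

(** Labels primed points: those outside the image of [s] fall into the exceptional block, whose
    label is [None]. *)
Definition im_restr s o := if `[< exists x, s x = o >] then o else None.

Lemma im_restrN s : im_restr s None = None.
Proof. by rewrite /im_restr; case: ifP. Qed.

Lemma im_restr_id s x : im_restr s (s x) = s x.
Proof. by rewrite /im_restr asboolT //; exists x. Qed.

Variant im_restr_spec s o : option X -> Prop :=
  | ImRestrSome x of s x = o : im_restr_spec s o o
  | ImRestrNone of (forall x, s x <> o) : im_restr_spec s o None.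

Lemma im_restrP s o : im_restr_spec s o (im_restr s o).
Proof.
rewrite /im_restr; case: asboolP => [[x sx]|ns]; first exact: ImRestrSome sx.
by apply: ImRestrNone => x sx; apply: ns; exists x.
Qed.

Lemma im_restrK s o : im_restr s (im_restr s o) = im_restr s o.
Proof.
by case: (im_restrP s o) => [x <-|_]; rewrite (im_restr_id, im_restrN).
Qed.

Lemma IS_inj s x y z : s x = Some z -> s y = Some z -> x = y.
Proof. by move=> sx sy; apply: (pmap_inj (i := s)); rewrite ?inE ?sx ?sy. Qed.

Lemma im_restr_mul s t o :
  im_restr (IS_mul s t) (im_restr t o) = im_restr (IS_mul s t) o.
Proof.
case: (im_restrP t o) => // nt; rewrite im_restrN.
case: im_restrP => // x; rewrite /= /pcomp.
by case: (s x) => //= y ty; case: (nt y).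
Qed.

(** If [z] is outside the image of [s], then a defined [t z] is outside the image of [s * t],
    because [t] is injective. *)
Lemma obind_im_restr s t o :
  obind t (im_restr s o) = im_restr (IS_mul s t) (obind t o).
Proof.
case: o => [z|]; last by rewrite !im_restrN.
case: im_restrP => [x sx|ns] /=.
  have <- : IS_mul s t x = t z by rewrite /= /pcomp sx.
  by rewrite im_restr_id.
case: im_restrP => // x; rewrite /= /pcomp.
case sx: (s x) => [y|] //= tyz; case tz: (t z) tyz => [w|] // ty.
by case: (ns x); rewrite sx (IS_inj ty tz).
Qed.

End ImageRestriction.

Section Embedding.
(** Only a bijection with [option X] is used, so that a union of sets can later take the place of
    [Y]. *)
Variables (X Y : Type) (ofY : Y -> option X) (toY : option X -> Y).
Hypotheses (ofYK : cancel ofY toY) (toYK : cancel toY ofY).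
Implicit Types (s t : IS X) (u v : Y + Y).

(* The block of [u] in the image of [s]: [Some z] stands for the block of
   [z'], where [z] is in the image of [s], and [None] for the exceptional
   block. *)
Definition label s u : option X := match u with
  | inl y => obind s (ofY y)
  | inr y => im_restr s (ofY y)
  end.

(** Supplies each block with a canonical primed point, through which paths are routed below. *)
Lemma label_inr s u : label s (inr (toY (label s u))) = label s u.
Proof.
rewrite /= toYK; case: u => y /=; last exact: im_restrK.
by case: (ofY y) => [x|] /=; rewrite (im_restr_id, im_restrN).
Qed.

Lemma label_inl s u : exists y, label s (inl y) = label s u.
Proof.
case: u => y; first by exists y.
rewrite [label s (inr y)]/=; case: im_restrP => [x sx|_].
  by exists (toY (Some x)); rewrite /= toYK.
by exists (toY None); rewrite /= toYK.
Qed.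

Lemma label_equivalence s : equivalence _ (fun u v => label s u = label s v).
Proof. by split=> [u|u v w -> ->|u v ->]. Qed.

Definition label_CS s : CS Y :=
  MkCS (eqclasses_partition (label_equivalence s)).

Lemma label_CSE s u v :
  same_block (label_CS s) u v <-> label s u = label s v.
Proof.
by apply: (same_block_eqclasses (label_equivalence s)).
Qed.

Lemma label_CS_IP s : label_CS s \in @IP_pred Y.
Proof.
apply/asboolP => _ [u _ <-] /=; split.
  by have [y yu] := label_inl s u; exists y; apply: esym.
by exists (toY (label s u)); apply/esym/label_inr.
Qed.

Definition label_IP s : IP Y := MkIP (label_CS_IP s).

Section Mul.
Variables s t : IS X.

Let G := union _ (Defs.lift 0 1 (same_block (label_CS s)))
                 (Defs.lift 1 2 (same_block (label_CS t))).
Let conn := clos_refl_sym_trans _ G.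

(** An invariant of connected components: the value on the middle layer is chosen so that the edges
    of both factors preserve it. *)
Let mul_label (p : nat * Y) := match p.1 with
  | 0 => label (IS_mul s t) (inl p.2)
  | 1 => obind t (im_restr s (ofY p.2))
  | _ => label (IS_mul s t) (inr p.2)
  end.

Lemma mul_label_l u : mul_label (layer 0 1 u) = obind t (label s u).
Proof. by case: u => y; rewrite /mul_label //=; case: (ofY y). Qed.

Lemma mul_label_r u :
  mul_label (layer 1 2 u) = im_restr (IS_mul s t) (label t u).
Proof.
by case: u => y; rewrite /mul_label /= (obind_im_restr, im_restr_mul).
Qed.

Lemma conn_mul_label p q : conn p q -> mul_label p = mul_label q.
Proof.
elim=> {p q} // [p q []|p q r _ -> _ -> //] [u [v [-> -> /label_CSE uv]]].
- by rewrite !mul_label_l uv.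
- by rewrite !mul_label_r uv.
Qed.

Lemma conn_l u v : label s u = label s v -> conn (layer 0 1 u) (layer 0 1 v).
Proof. by move=> /label_CSE uv; apply: rst_step; left; exists u, v. Qed.

Lemma conn_r u v : label t u = label t v -> conn (layer 1 2 u) (layer 1 2 v).
Proof. by move=> /label_CSE uv; apply: rst_step; right; exists u, v. Qed.

(** Converse to the invariant: the path ends at a vertex that depends only on the label for [s * t],
    so outer vertices with equal labels are connected. *)
Lemma conn_label u :
  conn (layer 0 2 u) (2, toY (label (IS_mul s t) u)).
Proof.
(* Broken paths reach layer 2 through [xbar], which lies in the exceptional block of [label_CS t]
   together with its copy. *)
have toN : conn (1, toY None) (2, toY None).
  apply: (@conn_r (inl _) (inr _)).
  by rewrite /= toYK im_restrN.
case: u => y.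
  have -> : label (IS_mul s t) (inl y) =
      label t (inl (toY (label s (inl y)))).
    by rewrite /= toYK; case: (ofY y).
  apply: (rst_trans _ _ _ (1, toY (label s (inl y)))).
    by apply: (@conn_l (inl _) (inr _)); rewrite label_inr.
  by apply: (@conn_r (inl _) (inr _)); rewrite label_inr.
rewrite [label _ _]/=; case: im_restrP => [x _|nst].
  by rewrite ofYK; apply: rst_refl.
case ty: _ / (im_restrP t (ofY y)) => [x tx|nt].
(* Here [x] is outside the image of [s], since otherwise [ofY y] would be a value of [s * t]; hence
   [label_CS s] joins [x] to [xbar] on layer 1. *)
- apply: (rst_trans _ _ _ (1, toY (Some x))).
    by apply: (@conn_r (inr _) (inl _)); rewrite /= ty toYK /= tx.
  apply: rst_trans toN; apply: (@conn_l (inr _) (inr _)).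
  rewrite /= !toYK im_restrN; case: im_restrP => // x' sx'.
  by case: (nst x'); rewrite /= /pcomp sx'.
- by apply: (@conn_r (inr _) (inr _)); rewrite /= ty toYK im_restrN.
Qed.

Lemma label_CS_mul : label_CS (IS_mul s t) = CS_mul (label_CS s) (label_CS t).
Proof.
have mulE u : mul_label (layer 0 2 u) = label (IS_mul s t) u by case: u.
apply: CS_eq => u v; rewrite CS_mulE.
rewrite (@prod_equiv_conn _ _ _ 0 1 2) // label_CSE; split=> [uv|].
  apply: rst_trans (conn_label u) _; apply: rst_sym.
  by rewrite uv; apply: conn_label.
by move/conn_mul_label; rewrite !mulE.
Qed.

End Mul.

Lemma label_IP_mul : {morph label_IP : s t / (s * t)%g >-> (s * t)%g}.
Proof. by move=> s t; apply: val_inj; apply: label_CS_mul. Qed.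

Lemma label_IP_inj : injective label_IP.
Proof.
(* The point [x] shares a block with the primed copy of [s x], [xbar] standing for an undefined
   value. Reading this block with the labels of [t] gives [t x]; exchanging [s] and [t] then forces
   equality. *)
have sub s t : label_CS s = label_CS t -> forall x, t x = s x \/ t x = None.
  move=> st x.
  have /label_CSE : label s (inl (toY (Some x))) = label s (inr (toY (s x))).
    by rewrite /= !toYK /= im_restr_id.
  rewrite st => /label_CSE; rewrite /= !toYK /= => ->.
  by case: im_restrP; [left|right].
move=> s t /(congr1 (@part_of Y)) /= st; apply: IS_eq => x.
by case: (sub s t st x) (sub t s (esym st) x) => [->//|->] [].
Qed.

End Embedding.

Section Adjunction.
Variables (T : Type) (X : set T) (xbar : T).
Let Y := X `|` [set xbar].

Lemma mem_setU1l (x : X) : val x \in Y.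
Proof. by rewrite inE; left; apply: set_valP. Qed.

Lemma mem_setU1r : xbar \in Y.
Proof. by rewrite inE; right. Qed.

Definition of_setU1 (y : Y) : option X := insub (val y).

Definition to_setU1 (o : option X) : Y :=
  if o is Some x then Sub (val x) (mem_setU1l x) else Sub xbar mem_setU1r.

Lemma of_setU1K : cancel of_setU1 to_setU1.
Proof.
move=> y; apply: val_inj; rewrite /of_setU1.
case: insubP => [x _ xy|]; first by rewrite /= -xy.
by move/negP; rewrite inE; case: (set_valP y).
Qed.

(** If [xbar] were in [X], [insub] would return [Some] at [xbar] and [None] would not be
    recovered. *)
Lemma to_setU1K : ~ X xbar -> cancel to_setU1 of_setU1.
Proof.
move=> nX [x|]; rewrite /of_setU1 /= ?valK //.
by apply: insubN; apply/negP; rewrite inE.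
Qed.

End Adjunction.

Theorem theorem5 (T : Type) (X : set T) (xbar : T) (xbarNX : ~ X xbar) :
  exists phi : {multiplicative IS X -> IP (X `|` [set xbar])}, injective phi.
Proof.
have K := @of_setU1K T X xbar.
have K' := to_setU1K xbarNX.
pose phi : {multiplicative IS X -> IP (X `|` [set xbar])} :=
  HB.pack (label_IP K') (isMultiplicative.Build _ _ _ (label_IP_mul K K')).
by exists phi; apply: label_IP_inj.
Qed.
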